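(* Let $\mathcal{D}$ be a description of a noisy circuit on $n$ qubits with $L$ layers and final state $\rho$, and let $\chi\in\mathbb{N}$ be a maximal bond dimension. Consider a trajectory sampling algorithm for $\mathcal{D}$ whose approximation subprocedure always outputs a matrix product state (MPS) of bond dimension at most $\chi$, and let $N$ be the number of independently sampled trajectories $|\hat\psi_1\rangle,\dots,|\hat\psi_N\rangle$. Then there exists $\epsilon\ge 0$ such that, with runtime $\mathrm{poly}(n,\chi,N)$, the trajectory sampling algorithm returns samples from an $(\epsilon,\chi)$-convex MPS witness for $\rho$, and such that, for any $\delta\in(0,1)$, with probability at least $1-\delta$ (over the $N$ sampled trajectories), $$\epsilon\;\le\;\hat\varepsilon_N+\sqrt{\frac{2}{N}\log\frac{1}{\delta}},$$ where $\hat\varepsilon_N=\frac1N\sum_{i=1}^N\varepsilon_{\mathrm{bound}}(\hat\psi_i)$ is the error estimator with threshold $\varepsilon_{\max}=2$.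
   Context: Norm: $\|A\|_{\mathrm{Tr}}=\mathrm{Tr}\sqrt{A^\dagger A}$ (Schatten 1-norm). $\log$ is the natural logarithm. Noisy circuit description $\mathcal{D}$: a linear ordering of the $n$ qubits; an initial unit vector $|\psi^{(0)}\rangle$ given as an MPS; and a sequence of $L$ efficiently representable and applicable quantum channels (CPTP maps) $\Lambda^{(1)},\dots,\Lambda^{(L)}$ on $n$ qubits (for instance, each consisting of one- or two-qubit unitaries on disjoint sets of qubits composed with single-qubit noise channels). $L$ is polynomial in $n$. The final state is $\rho=\Lambda^{(L)}\circ\cdots\circ\Lambda^{(1)}[|\psi^{(0)}\rangle\langle\psi^{(0)}|]$. MPS: a state $\sum_{\sigma\in\{0,1\}^n}A^{[1]}_{\sigma_1}\cdots A^{[n]}_{\sigma_n}|\sigma\rangle$ with matrices $A^{[k]}_{\sigma_k}$ (row/column vectors at the two ends); its bond dimension is the largest matrix dimension. As usual for MPS of bond dimension $\chi$, applying local gates or local Kraus operators, norms, inner products, Schmidt decompositions across cuts and truncations are taken to be computable in $\mathrm{poly}(n,\chi)$ time. $(\epsilon,\chi)$-convex MPS witness for $\rho$: an ensemble $\{q_i,|\psi_i\rangle\}_i$ ($q_i$ a probability distribution, $|\psi_i\rangle$ pure states) such that each $|\psi_i\rangle$ is an MPS of bond dimension $\le\chi$ with respect to the given qubit ordering and $\|\rho-\sum_i q_i|\psi_i\rangle\langle\psi_i|\|_{\mathrm{Tr}}\le\epsilon$. ''Returns samples from the witness'' means it outputs $|\psi_i\rangle$ with probability $q_i$, independently for each sample.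 Trajectory sampling algorithm: start from $|\phi^{(0)}\rangle=|\psi^{(0)}\rangle$. At layer $\ell=1,\dots,L$, choose (by an efficient rule that may depend on the whole history of the trajectory) a Kraus decomposition $\{K_j\}_j$ of $\Lambda^{(\ell)}$, sample $j$ with probability $p_j=\|K_j|\phi^{(\ell-1)}\rangle\|_2^2$, set $|\xi^{(\ell)}\rangle=p_j^{-1/2}K_j|\phi^{(\ell-1)}\rangle$ (input state of the new node), and apply the approximation subprocedure, an efficient map sending $|\xi^{(\ell)}\rangle$ to a unit vector $|\phi^{(\ell)}\rangle$ that is an MPS of bond dimension $\le\chi$ (e.g. truncation followed by renormalization). The output $|\hat\psi\rangle=|\phi^{(L)}\rangle$ is one trajectory. Errors: for a sampled trajectory $\hat\psi$, $\varepsilon_{\mathrm{approx}}(\hat\psi,\ell)=\big\||\xi^{(\ell)}\rangle\langle\xi^{(\ell)}|-|\phi^{(\ell)}\rangle\langle\phi^{(\ell)}|\big\|_{\mathrm{Tr}}$. For a threshold $\varepsilon_{\max}$, $\varepsilon_{\mathrm{bound}}(\hat\psi)=\sum_{\ell=1}^L\varepsilon_{\mathrm{approx}}(\hat\psi,\ell)$ if this sum is at most $\varepsilon_{\max}-2$, and $\varepsilon_{\mathrm{bound}}(\hat\psi)=\varepsilon_{\max}$ otherwise. Here $\varepsilon_{\max}=2$. *)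

(* Defs.v *)
From mathcomp Require Import all_boot all_order all_algebra.
From mathcomp Require Import fingroup perm sesquilinear spectral.
From mathcomp Require Import mxtens complex.
From mathcomp Require Import reals exp.

Set Implicit Arguments.
Unset Strict Implicit.
Unset Printing Implicit Defensive.
Import Order.TTheory GRing.Theory Num.Theory.
Local Open Scope ring_scope.
Local Open Scope sesquilinear_scope.

(* The computational basis of n qubits is {0,1}^n = n.-tuple bool, enumerated
   by enum_val / enum_rank. *)
Notation hdim n := #|{: n.-tuple bool}|.

Notation ket R n := 'cV[R[i]]_(hdim n).
Notation operator R n := 'M[R[i]]_(hdim n).
Notation superop R n := {linear operator R n -> operator R n}.

Definition norm2 (R : realType) (m : nat) (v : 'cV[R[i]]_m) : R :=
  Num.sqrt (\sum_i Normc.normc (v i 0) ^+ 2).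

Definition unit_vector (R : realType) (m : nat) (v : 'cV[R[i]]_m) : Prop :=
  norm2 v = 1.

Definition projector (R : realType) (m : nat) (v : 'cV[R[i]]_m) : 'M[R[i]]_m :=
  v *m v ^t*.

(* Functional calculus through the unitary diagonalization
   A = (spectralmx A)^-1 diag (spectral_diag A) (spectralmx A) of a normal A;
   for A positive semidefinite this is its positive semidefinite square root. *)
Definition sqrtmx (R : realType) (m : nat) (A : 'M[R[i]]_m) : 'M[R[i]]_m :=
  invmx (spectralmx A) *m diag_mx (map_mx sqrtC (spectral_diag A))
    *m spectralmx A.

Definition trace_norm (R : realType) (m : nat) (A : 'M[R[i]]_m) : R :=
  complex.Re (\tr (sqrtmx (A ^t* *m A))).

Definition psd (R : realType) (m : nat) (A : 'M[R[i]]_m) : Prop :=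
  A \is hermsymmx /\ forall v : 'cV[R[i]]_m, 0 <= (v ^t* *m A *m v) 0 0.

(* The (i, j) block of size m x m of a matrix over C^k (x) C^m. *)
Definition tens_block (R : realType) (k m : nat) (X : 'M[R[i]]_(k * m))
    (i j : 'I_k) : 'M[R[i]]_m :=
  \matrix_(a, b) X (mxtens_index (i, a)) (mxtens_index (j, b)).

Definition ampliation (R : realType) (m k : nat)
    (F : 'M[R[i]]_m -> 'M[R[i]]_m) (X : 'M[R[i]]_(k * m)) : 'M[R[i]]_(k * m) :=
  \sum_i \sum_j (delta_mx i j : 'M[R[i]]_k) *t F (tens_block X i j).

Definition cptp (R : realType) (n : nat) (F : superop R n) : Prop :=
  (forall (k : nat) (X : 'M[R[i]]_(k * hdim n)), psd X -> psd (ampliation F X))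
  /\ (forall X, \tr (F X) = \tr X).

Definition kraus_decomposition (R : realType) (n : nat) (F : superop R n)
    (Ks : seq (operator R n)) : Prop :=
  forall X, F X = \sum_(K <- Ks) K *m X *m K ^t*.

(* Open chain of site tensors: [mps_from C d m] has m sites, left bond of
   dimension d and right end of dimension 1.  An MPS on n qubits has left
   dimension 1, so its end tensors are row/column vectors. *)
Inductive mps_from (C : Type) : nat -> nat -> Type :=
| MPSend : mps_from C 1 0
| MPSsite d d' m :
    (bool -> 'M[C]_(d, d')) -> mps_from C d' m -> mps_from C d m.+1.

Notation mps R n := (mps_from R[i] 1 n).

Fixpoint bond_dim (C : Type) (d m : nat) (M : mps_from C d m) : nat :=
  match M with
  | MPSend => 1
  | MPSsite d _ _ _ M' => maxn d (bond_dim M')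
  end.

Fixpoint contract (R : realType) (d m : nat) (M : mps_from R[i] d m)
    (s : seq bool) : 'cV[R[i]]_d :=
  match M in mps_from _ d _ return 'cV[R[i]]_d with
  | MPSend => 1%:M
  | MPSsite _ _ _ A M' => A (head false s) *m contract M' (behead s)
  end.

(* Site k of the chain carries the qubit [ord k]. *)
Definition mps_state (R : realType) (n : nat) (ord : 'S_n) (M : mps R n)
    : ket R n :=
  \col_x contract M [seq tnth (enum_val x) (ord k) | k <- enum 'I_n] 0 0.

Record circuit (R : realType) (n : nat) := Circuit {
  qubit_order : 'S_n;
  initial : mps R n;
  layers : nat;
  (* only indices below [layers] are meaningful; channel l is the (l+1)-st
     layer *)
  channel : nat -> superop R n }.

Definition mps_ket (R : realType) (n : nat) (D : circuit R n) (M : mps R n)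
    : ket R n := mps_state (qubit_order D) M.

Fixpoint state_after (R : realType) (n : nat) (D : circuit R n) (l : nat)
    : operator R n :=
  match l with
  | 0 => projector (mps_ket D (initial D))
  | l'.+1 => channel D l' (state_after D l')
  end.

Definition final_state (R : realType) (n : nat) (D : circuit R n)
    : operator R n := state_after D (layers D).

Definition noisy_circuit (R : realType) (n : nat) (D : circuit R n) : Prop :=
  [/\ (0 < layers D)%N, unit_vector (mps_ket D (initial D)) &
      forall l, (l < layers D)%N -> cptp (channel D l)].

Definition convex_mps_witness (R : realType) (n : nat) (ord : 'S_n)
    (rho : operator R n) (eps : R) (chi : nat) (E : seq (R * ket R n)) : Prop :=
  [/\ all (fun e => 0 <= e.1) E,
      \sum_(e <- E) e.1 = 1,
      forall e, e \in E -> unit_vector e.2 /\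
        exists2 M : mps R n, mps_state ord M = e.2 & (bond_dim M <= chi)%N &
      trace_norm (rho - \sum_(e <- E) e.1%:C%C *: projector e.2) <= eps].

(* Finite randomized computations with a running time: the list of possible
   runs, each with its probability, time and returned value. *)
Definition comp (R : realType) (T : Type) := seq (R * nat * T).

Definition ret (R : realType) (T : Type) (a : T) : comp R T := [:: (1, 0%N, a)].

Definition bind (R : realType) (T U : Type) (m : comp R T) (f : T -> comp R U)
    : comp R U :=
  [seq (x.1.1 * y.1.1, (x.1.2 + y.1.2)%N, y.2) | x <- m, y <- f x.2].

Definition tick (R : realType) (t : nat) : comp R unit := [:: (1, t, tt)].

Definition sample (R : realType) (T : Type) (s : seq (R * T)) : comp R T :=
  [seq (x.1, 0%N, x.2) | x <- s].

Fixpoint repeat (R : realType) (T : Type) (N : nat) (m : comp R T)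
    : comp R (seq T) :=
  match N with
  | 0 => ret R [::]
  | N'.+1 => bind m (fun a => bind (repeat N' m) (fun s => ret R (a :: s)))
  end.

Definition Pr (R : realType) (T : Type) (m : comp R T) (P : pred T) : R :=
  \sum_(x <- m | P x.2) x.1.1.

Definition runtime_le (R : realType) (T : Type) (m : comp R T) (t : nat) : bool :=
  all (fun x => x.1.2 <= t)%N m.

Record node (R : realType) (n : nat) := Node {
  outcome : nat;
  node_in : mps R n;     (* before approximation *)
  node_out : mps R n }.  (* after approximation *)

Notation history R n := (seq (node R n)).

(* The freely chosen ingredients of a trajectory sampling algorithm, with their
   running times.  Their specification is [correct_algorithm] below. *)
Record algorithm (R : realType) (n : nat) := Algorithm {
  kraus_rule : history R n -> seq (operator R n);
  kraus_time : history R n -> nat;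
  (* MPS form of the normalized post-measurement state for outcome j; the time
     includes the sampling of j, which need not enumerate the Kraus operators *)
  update : history R n -> nat -> mps R n;
  update_time : history R n -> nat -> nat;
  approx : mps R n -> mps R n;
  approx_time : mps R n -> nat }.

Definition current (R : realType) (n : nat) (D : circuit R n) (h : history R n)
    : mps R n := last (initial D) [seq node_out v | v <- h].

Definition branch (R : realType) (n : nat) (D : circuit R n)
    (alg : algorithm R n) (h : history R n) (j : nat) : ket R n :=
  (kraus_rule alg h)`_j *m mps_ket D (current D h).

Definition branch_prob (R : realType) (n : nat) (D : circuit R n)
    (alg : algorithm R n) (h : history R n) (j : nat) : R :=
  norm2 (branch D alg h j) ^+ 2.

Definition outcomes (R : realType) (n : nat) (D : circuit R n)
    (alg : algorithm R n) (h : history R n) : seq nat :=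
  [seq j <- iota 0 (size (kraus_rule alg h)) | branch_prob D alg h j != 0].

Definition new_node (R : realType) (n : nat) (alg : algorithm R n)
    (h : history R n) (j : nat) : node R n :=
  Node j (update alg h j) (approx alg (update alg h j)).

(* One layer; the extra unit of time accounts for the control of the loop. *)
Definition run_layer (R : realType) (n : nat) (D : circuit R n)
    (alg : algorithm R n) (h : history R n) : comp R (history R n) :=
  bind (tick R (kraus_time alg h).+1) (fun _ =>
  bind (sample [seq (branch_prob D alg h j, j) | j <- outcomes D alg h])
    (fun j =>
  bind (tick R (update_time alg h j)) (fun _ =>
  bind (tick R (approx_time alg (update alg h j))) (fun _ =>
  ret R (rcons h (new_node alg h j)))))).

Fixpoint run_layers (R : realType) (n : nat) (D : circuit R n)
    (alg : algorithm R n) (l : nat) : comp R (history R n) :=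
  match l with
  | 0 => ret R [::]
  | l'.+1 => bind (run_layers D alg l') (run_layer D alg)
  end.

Definition run_trajectory (R : realType) (n : nat) (D : circuit R n)
    (alg : algorithm R n) : comp R (history R n) :=
  run_layers D alg (layers D).

(* Histories that occur with nonzero probability before the last layer. *)
Inductive reachable (R : realType) (n : nat) (D : circuit R n)
    (alg : algorithm R n) : history R n -> Prop :=
| reach_init : reachable D alg [::]
| reach_step h j : reachable D alg h -> ((size h).+1 < layers D)%N ->
    j \in outcomes D alg h -> reachable D alg (rcons h (new_node alg h j)).

Definition correct_algorithm (R : realType) (n : nat) (D : circuit R n)
    (chi : nat) (alg : algorithm R n) : Prop :=
  [/\ forall h, reachable D alg h ->
        kraus_decomposition (channel D (size h)) (kraus_rule alg h),
      forall h j, reachable D alg h -> j \in outcomes D alg h ->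
        mps_ket D (update alg h j) =
        ((Num.sqrt (branch_prob D alg h j))^-1)%:C%C *: branch D alg h j &
      forall M : mps R n, unit_vector (mps_ket D M) ->
        unit_vector (mps_ket D (approx alg M))
        /\ (bond_dim (approx alg M) <= chi)%N].

(* "x is poly(s)", s being the sum of the size parameters. *)
Definition poly_bound (c k s : nat) : nat := (c * s.+1 ^ k)%N.

Definition history_bond (R : realType) (n : nat) (D : circuit R n)
    (h : history R n) : nat :=
  maxn (bond_dim (initial D))
    (\max_(v <- h) maxn (bond_dim (node_in v)) (bond_dim (node_out v))).

Definition efficient_circuit (R : realType) (n : nat) (D : circuit R n)
    (chi c k : nat) : Prop :=
  (layers D <= poly_bound c k n)%N
  /\ (bond_dim (initial D) <= poly_bound c k (n + chi))%N.

(* Each primitive runs in time polynomial in the size of its input.  The bound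
   on the bond dimension of the updated state expresses that the channels are
   efficiently applicable to an MPS, with an MPS as result. *)
Definition efficient_algorithm (R : realType) (n : nat) (D : circuit R n)
    (alg : algorithm R n) (c k : nat) : Prop :=
  [/\ forall h, reachable D alg h ->
        (kraus_time alg h
           <= poly_bound c k (n + size h + history_bond D h))%N,
      forall h j, reachable D alg h -> j \in outcomes D alg h ->
        (update_time alg h j
           <= poly_bound c k (n + bond_dim (current D h)))%N,
      forall h j, reachable D alg h -> j \in outcomes D alg h ->
        (bond_dim (update alg h j)
           <= poly_bound c k (n + bond_dim (current D h)))%N &
      forall M : mps R n, unit_vector (mps_ket D M) ->
        (approx_time alg M <= poly_bound c k (n + bond_dim M))%N].

Definition output (R : realType) (n : nat) (D : circuit R n) (h : history R n)
    : ket R n := mps_ket D (current D h).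

Definition ensemble_mass (R : realType) (n : nat) (E : seq (R * ket R n))
    (v : ket R n) : R := \sum_(e <- E | e.2 == v) e.1.

(* N independent samples of the ensemble; probabilities of equal states are
   added up. *)
Definition returns_samples (R : realType) (n : nat) (D : circuit R n) (N : nat)
    (m : comp R (seq (history R n))) (E : seq (R * ket R n)) : Prop :=
  forall vs : N.-tuple (ket R n),
    Pr m (fun hs => [seq output D h | h <- hs] == vs)
    = \prod_(v <- vs) ensemble_mass E v.

Definition eps_approx (R : realType) (n : nat) (D : circuit R n) (v : node R n)
    : R :=
  trace_norm (projector (mps_ket D (node_in v))
              - projector (mps_ket D (node_out v))).

Definition eps_bound (R : realType) (n : nat) (D : circuit R n) (eps_max : R)
    (h : history R n) : R :=
  let s := \sum_(v <- h) eps_approx D v in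
  if s <= eps_max - 2 then s else eps_max.

Definition error_estimator (R : realType) (n : nat) (D : circuit R n)
    (eps_max : R) (hs : seq (history R n)) : R :=
  (size hs)%:R^-1 * \sum_(h <- hs) eps_bound D eps_max h.

(* Main.v *)
(* For the threshold 2, [eps_bound] is 0 on the trajectories all of whose
   approximations are exact, and 2 on the other ones.  Let G be the part of the
   output mixture sigma coming from the exact trajectories, and B the other part.
   Positivity of the channels gives rho - G >= 0 by induction on the layers: an
   exact approximation does not change the projector, and abandoning a branch
   only decreases G.  Hence rho - sigma = (rho - G) - B is a difference of two
   positive operators, both of trace Pr(not exact), so that its trace norm is at
   most 2 Pr(not exact), which is the mean of [eps_bound].  This mean is taken as
   eps, and the confidence bound is Hoeffding's inequality for i.i.d. variables
   with values in {0, 2}. *)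
From HB Require Import structures.
Require Import Defs.
From mathcomp Require Import all_boot all_order all_algebra.
From mathcomp Require Import ring lra zify.
From mathcomp Require Import sesquilinear spectral complex.
From mathcomp Require Import boolp classical_sets reals topology normedtype.
From mathcomp Require Import sequences derive realfun exp.

Set Implicit Arguments.
Unset Strict Implicit.
Unset Printing Implicit Defensive.
Import Order.TTheory GRing.Theory Num.Theory numFieldNormedType.Exports.
Local Open Scope ring_scope.
Local Open Scope sesquilinear_scope.

(** * The trace norm *)

(** Functional calculus does not depend on the chosen diagonalization. The change of basis [W]
    intertwines [d] and [e], so its entry (i, j) vanishes unless [d] at j equals [e] at i; hence it
    also intertwines their images under [f]. *)
Lemma similar_diag_map (F : fieldType) (f : F -> F) (m : nat)
    (U V : 'M[F]_m) (d e : 'rV[F]_m) :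
  U \in unitmx -> V \in unitmx ->
  invmx U *m diag_mx d *m U = invmx V *m diag_mx e *m V ->
  invmx U *m diag_mx (map_mx f d) *m U = invmx V *m diag_mx (map_mx f e) *m V.
Proof.
move=> Uu Vu eqUV.
pose W := V *m invmx U.
have Wde : W *m diag_mx d = diag_mx e *m W.
  have := congr1 (fun X => V *m X *m invmx U) eqUV.
  by rewrite /W !mulmxA mulmxV // mul1mx -!mulmxA mulmxV // mulmx1 !mulmxA.
have Wf : W *m diag_mx (map_mx f d) = diag_mx (map_mx f e) *m W.
  clearbody W; apply/matrixP=> i j.
  have := congr1 (fun X : 'M_m => X i j) Wde.
  rewrite !mul_mx_diag !mul_diag_mx !mxE => eqW.
  have [->|Wn0] := eqVneq (W i j) 0; first by rewrite mul0r mulr0.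
  by rewrite mulrC; congr (f _ * _); apply: (mulIf Wn0); rewrite mulrC.
have := congr1 (fun X => invmx V *m X *m U) Wf.
by rewrite /W !mulmxA mulVmx // mul1mx => ->; rewrite -!mulmxA mulVmx // mulmx1.
Qed.

(** Taking traces removes the conjugations, so a spectral sum may be evaluated in any
    diagonalization, not only in the one picked by [spectralmx]. *)
Lemma similar_diag_trace (F : fieldType) (f : F -> F) (m : nat)
    (U V : 'M[F]_m) (d e : 'rV[F]_m) :
  U \in unitmx -> V \in unitmx ->
  invmx U *m diag_mx d *m U = invmx V *m diag_mx e *m V ->
  \sum_i f (d 0 i) = \sum_i f (e 0 i).
Proof.
move=> Uu Vu /(similar_diag_map f Uu Vu)/(congr1 mxtrace).
rewrite !(mxtrace_mulC _ U) !(mxtrace_mulC _ V) !mulmxA !mulmxV // !mul1mx.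
by rewrite !mxtrace_diag; under eq_bigr do rewrite mxE;
   under [X in _ = X -> _]eq_bigr do rewrite mxE.
Qed.

Section TraceNorm.
Variables (R : realType) (m : nat).
Implicit Types (A P Q : 'M[R[i]]_m) (v : 'cV[R[i]]_m).

Lemma conjt_mul p q r (A : 'M[R[i]]_(p, q)) (B : 'M[R[i]]_(q, r)) :
  (A *m B) ^t* = B ^t* *m A ^t*.
Proof. by rewrite trmx_mul map_mxM. Qed.

Lemma hermsymmxP A : reflect (A ^t* = A) (A \is hermsymmx).
Proof.
by apply: (iffP (is_hermitianmxP _ _ _)); rewrite expr0 scale1r => eqA //.
Qed.

Lemma row_form p (V : 'M[R[i]]_(p, m)) A i :
  (V *m A *m V ^t*) i i = ((row i V) *m A *m (row i V) ^t*) 0 0.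
Proof.
rewrite -row_mul !mxE; apply: eq_bigr => j _; rewrite !mxE //.
Qed.

Lemma psd_form_ge0 p (V : 'M[R[i]]_(p, m)) P i :
  psd P -> 0 <= (V *m P *m V ^t*) i i.
Proof. by case=> _ /(_ ((row i V) ^t*)); rewrite trmxCK -row_form. Qed.

Lemma spectral_diagE A : A \is normalmx ->
  diag_mx (spectral_diag A) = spectralmx A *m A *m (spectralmx A) ^t*.
Proof.
move=> /orthomx_spectralP eqA.
rewrite -invmx_unitary ?spectral_unitarymx // [X in _ = _ *m X *m _]eqA.
by rewrite !mulmxA mulmxV ?spectral_unit // mul1mx -mulmxA mulmxV
           ?spectral_unit // mulmx1.
Qed.

Lemma psd_gram A : psd (A ^t* *m A).
Proof.
split=> [|v]; first by apply/hermsymmxP; rewrite conjt_mul trmxCK.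
rewrite mulmxA -conjt_mul -mulmxA mxE sumr_ge0 // => j _.
by rewrite !mxE mulrC mul_conjC_ge0.
Qed.

Lemma spectral_diag_ge0 A i : psd A -> 0 <= spectral_diag A 0 i.
Proof.
move=> psdA; have := psd_form_ge0 (spectralmx A) i psdA.
by rewrite -spectral_diagE ?hermitian_normalmx ?mxE ?eqxx //; case: psdA.
Qed.

(** The trace is a sum of square roots of eigenvalues of a positive matrix, so taking the real part
    in [trace_norm] loses nothing. *)
Lemma trace_normE A :
  (trace_norm A)%:C%C = \sum_i sqrtC (spectral_diag (A ^t* *m A) 0 i).
Proof.
rewrite /trace_norm /sqrtmx mxtrace_mulC mulmxA mulmxV ?spectral_unit //.
rewrite mul1mx mxtrace_diag; under eq_bigr do rewrite mxE.
rewrite RRe_real //; apply: ger0_real; apply: sumr_ge0 => i _.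
by rewrite sqrtC_ge0 spectral_diag_ge0 //; apply: psd_gram.
Qed.

Lemma trace_norm_ge0 A : 0 <= trace_norm A.
Proof.
rewrite -ler0c trace_normE sumr_ge0 // => i _.
by rewrite sqrtC_ge0 spectral_diag_ge0 //; apply: psd_gram.
Qed.

(** The nonnegative spectral sum vanishes only if the Gram matrix of [A] is 0, and the diagonal of
    the Gram matrix holds the squared column norms of [A]. *)
Lemma trace_norm_eq0 A : trace_norm A = 0 -> A = 0.
Proof.
move=> /(congr1 (fun x => x%:C%C)); rewrite trace_normE => /eqP.
have gram := psd_gram A.
rewrite psumr_eq0; last by move=> i _; rewrite sqrtC_ge0 spectral_diag_ge0.
move=> /allP d0.
have AA0 : A ^t* *m A = 0.
  have /hermitian_normalmx/orthomx_spectralP -> := gram.1.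
  suff -> : spectral_diag (A ^t* *m A) = 0 by rewrite raddf0 mulmx0 mul0mx.
  apply/rowP => i; have := d0 i; rewrite mem_index_enum sqrtC_eq0 mxE.
  by move=> /(_ isT)/eqP.
apply/matrixP=> i j; have := congr1 (fun X : 'M_m => X j j) AA0.
rewrite !mxE => /eqP; rewrite psumr_eq0; last first.
  by move=> l _; rewrite !mxE mulrC mul_conjC_ge0.
move=> /allP /(_ i); rewrite mem_index_enum => /(_ isT).
by rewrite !mxE mulrC mul_conjC_eq0 => /eqP.
Qed.

(** In an orthonormal eigenbasis of P - Q the eigenvalues are p_i - q_i, where p_i and q_i are the
    nonnegative diagonal entries of P and Q. The sum of |p_i - q_i| is at most that of p_i + q_i,
    the sum of the traces. *)
Lemma trace_norm_psdB P Q : psd P -> psd Q ->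
  (trace_norm (P - Q))%:C%C <= \tr P + \tr Q.
Proof.
move=> psdP psdQ; set A := P - Q.
have hA : A ^t* = A.
  have [/hermsymmxP hP _] := psdP; have [/hermsymmxP hQ _] := psdQ.
  by rewrite /A linearB /= map_mxB hP hQ.
have nA : A \is normalmx by apply/hermitian_normalmx/hermsymmxP.
have nAA : A ^t* *m A \is normalmx by apply: hermitian_normalmx (psd_gram A).1.
set V := spectralmx A; have Vu : V \in unitmx by apply: spectral_unit.
have eqA := orthomx_spectralP nA.
rewrite trace_normE.
(* Since [A] is Hermitian, its eigenbasis [V] also diagonalizes the Gram matrix, with squared
   eigenvalues. *)
have -> : \sum_i sqrtC (spectral_diag (A ^t* *m A) 0 i)
          = \sum_i sqrtC ((map_mx (fun x => x ^+ 2) (spectral_diag A)) 0 i).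
  apply: (similar_diag_trace _ (spectral_unit (A ^t* *m A)) Vu).
  rewrite -(orthomx_spectralP nAA) hA {1 2}eqA -!mulmxA (mulKVmx Vu).
  congr (_ *m _); rewrite !mulmxA; congr (_ *m _).
  by rewrite mulmx_diag; congr diag_mx; apply/rowP=> i; rewrite !mxE expr2.
have -> : \tr P + \tr Q
    = \sum_i ((V *m P *m V ^t*) i i + (V *m Q *m V ^t*) i i).
  rewrite big_split /= -/(mxtrace (V *m P *m _)) -/(mxtrace (V *m Q *m _)).
  rewrite -invmx_unitary ?spectral_unitarymx //.
  by rewrite !(mxtrace_mulC _ (invmx V)) !mulmxA !mulVmx // !mul1mx.
apply: ler_sum => i _; rewrite mxE.
have -> : spectral_diag A 0 i = (V *m P *m V ^t*) i i - (V *m Q *m V ^t*) i i.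
  have := congr1 (fun X : 'M_m => X i i) (spectral_diagE nA).
  rewrite /= /A mulmxBr mulmxBl => eqi; move: eqi.
  by rewrite mxE eqxx mulr1n => ->; rewrite !mxE.
set p := (V *m P *m _) i i; set q := (V *m Q *m _) i i.
have p0 : 0 <= p by apply: psd_form_ge0.
have q0 : 0 <= q by apply: psd_form_ge0.
(* As p - q is real, the root of its square is |p - q|. *)
rewrite -real_normK ?rpredB ?ger0_real // sqrCK ?normr_ge0 //.
by apply: le_trans (ler_normB _ _) _; rewrite !ger0_norm.
Qed.

End TraceNorm.

(** * Rank-one projectors and the cone of positive semidefinite matrices *)

Section Projectors.
Variables (R : realType) (m : nat).
Implicit Types (A P Q X K : 'M[R[i]]_m) (v : 'cV[R[i]]_m).

Lemma trace_projector v : \tr (projector v) = (norm2 v ^+ 2)%:C%C.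
Proof.
rewrite /norm2 sqr_sqrtr; last by rewrite sumr_ge0 // => i _; rewrite sqr_ge0.
rewrite rmorph_sum; apply: eq_bigr => i _; rewrite !mxE big_ord1 !mxE.
by rewrite -normCK rmorphXn.
Qed.

Lemma unit_vectorP v : unit_vector v <-> \tr (projector v) = 1.
Proof.
rewrite trace_projector /unit_vector; split=> [->|]; first by rewrite expr1n.
move=> /complexI /eqP; rewrite sqrp_eq1; first by move/eqP.
exact: sqrtr_ge0.
Qed.

Lemma norm2_eq0 v : norm2 v = 0 -> v = 0.
Proof.
move=> /eqP; rewrite -sqrf_eq0 /norm2 sqr_sqrtr; last first.
  by rewrite sumr_ge0 // => i _; rewrite sqr_ge0.
rewrite psumr_eq0 => [/allP v0|i _]; last by rewrite sqr_ge0.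
apply/colP => i; have := v0 i; rewrite mem_index_enum => /(_ isT).
by rewrite sqrf_eq0 mxE => /eqP/Normc.eq0_normc.
Qed.

Lemma projector_mul K v : projector (K *m v) = K *m projector v *m K ^t*.
Proof. by rewrite /projector conjt_mul !mulmxA. Qed.

Lemma projectorZ (a : R) v :
  projector (a%:C%C *: v) = (a ^+ 2)%:C%C *: projector v.
Proof.
rewrite /projector; apply/matrixP=> i j; rewrite !mxE !big_ord1 !mxE.
rewrite rmorphM /= conj_Creal; last by apply/complex_realP; exists a.
by rewrite rmorphXn /=; ring.
Qed.

Lemma psd0 : psd (0 : 'M[R[i]]_m).
Proof.
split=> [|v]; first by apply/hermsymmxP; rewrite trmx0 map_mx0.
by rewrite mulmx0 mul0mx mxE.
Qed.

Lemma psdD P Q : psd P -> psd Q -> psd (P + Q).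
Proof.
move=> [/hermsymmxP hP P0] [/hermsymmxP hQ Q0]; split=> [|v].
  by apply/hermsymmxP; rewrite linearD /= map_mxD hP hQ.
by rewrite mulmxDr mulmxDl mxE addr_ge0.
Qed.

Lemma psd_sum (I : Type) (r : seq I) (S : pred I) (F : I -> 'M[R[i]]_m) :
  (forall i, S i -> psd (F i)) -> psd (\sum_(i <- r | S i) F i).
Proof. by move=> F0; apply: big_ind => //; [exact: psd0|exact: psdD]. Qed.

Lemma psdZ (a : R) P : 0 <= a -> psd P -> psd (a%:C%C *: P).
Proof.
move=> a0 [/hermsymmxP hP P0]; split=> [|v].
  apply/hermsymmxP/matrixP=> i j; rewrite -[in RHS]hP !mxE rmorphM /=.
  by rewrite conj_Creal //; apply/complex_realP; exists a.
by rewrite -scalemxAr -scalemxAl mxE mulr_ge0 ?ler0c.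
Qed.

Lemma psd_conj K P : psd P -> psd (K *m P *m K ^t*).
Proof.
move=> [/hermsymmxP hP P0]; split=> [|v].
  by apply/hermsymmxP; rewrite !conjt_mul trmxCK hP mulmxA.
by have := P0 (K ^t* *m v); rewrite conjt_mul trmxCK !mulmxA.
Qed.

Lemma psd_projector v : psd (projector v).
Proof.
split=> [|w]; first by apply/hermsymmxP; rewrite /projector conjt_mul trmxCK.
rewrite /projector mulmxA -mulmxA -[v ^t* *m w]trmxCK conjt_mul trmxCK.
by rewrite mxE big_ord1 !mxE mul_conjC_ge0.
Qed.

End Projectors.

(** * Hoeffding's inequality *)

Section Hoeffding.
Variable R : realType.
Implicit Types (a b m s x : R) (f g : R -> R).

Lemma derive_le0_nincr_ge0 f (df : R -> R) :
  (forall x, is_derive x (1 : R) f (df x)) ->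
  (forall x, 0 <= x -> df x <= 0) ->
  forall x, 0 <= x -> f x <= f 0.
Proof.
move=> fdf df_le0 x x0.
apply: (@ler0_derive1_nincry R f 0) => //.
- move=> y; rewrite in_itv /= andbT => y0.
  by rewrite derive1E derive_val df_le0 // ltW.
- apply: continuous_subspaceT => y.
  by apply: differentiable_continuous; apply/derivable1_diffP.
Qed.

Lemma is_derive_div f g df dg x :
  g x != 0 -> is_derive x (1 : R) f df -> is_derive x (1 : R) g dg ->
  is_derive x (1 : R) (fun y => f y / g y)
    ((df * g x - f x * dg) / g x ^+ 2).
Proof.
move=> gn0 fdf gdg.
have gV : is_derive x (1 : R) (fun y => (g y)^-1) (- g x ^- 2 *: dg).
  split; first exact: derivableV.
  by rewrite deriveV // derive_val.
apply: is_derive_eq; rewrite /GRing.scale /=.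
by field.
Qed.

(** With arbitrary coefficients the lemma applies again to the derivative, after changing the sign
    of [b]. *)
Lemma is_derive_exp2 a b x :
  is_derive x (1 : R) (fun y => a * expR y + b * expR (- y))
    (a * expR x - b * expR (- x)).
Proof.
have dN : is_derive x (1 : R) (fun y => expR (- y)) (- expR (- x)).
  by apply: is_derive_eq; rewrite /GRing.scale /=; ring.
have d1 : is_derive x (1 : R) (fun y => a * expR y) (a * expR x).
  exact: is_deriveZ.
have d2 : is_derive x (1 : R) (fun y => b * expR (- y)) (b * (- expR (- x))).
  exact: is_deriveZ.
by rewrite -mulrN; exact: (is_deriveD d1 d2).
Qed.

(** The left side D(s) is the moment generating function of a variable with values -1 and 1 and mean
    m. With N = D' one has N' = D, so (N/D)' = 1 - (N/D)^2 <= 1 and N/D <= m + x on x >= 0. As m + x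
    is the derivative of the exponent on the right, D divided by the right side is nonincreasing
    from its value 1 at 0. *)
Lemma hoeffding_two_point m s : -1 <= m -> m <= 1 -> 0 <= s ->
  (1 + m) / 2 * expR s + (1 - m) / 2 * expR (- s) <= expR (m * s + s ^+ 2 / 2).
Proof.
move=> m_ge m_le.
set a := (1 + m) / 2; set b := (1 - m) / 2.
have a0 : 0 <= a by rewrite /a; lra.
have b0 : 0 <= b by rewrite /b; lra.
have ab : a + b = 1 by rewrite /a /b; field.
have ab' : a - b = m by rewrite /a /b; field.
pose D x := a * expR x + b * expR (- x).
pose N x := a * expR x - b * expR (- x).
have D_gt0 x : 0 < D x.
  have e0 := expR_gt0 x; have e0' := expR_gt0 (- x).
  rewrite /D; have [a_gt|a_le] := ltP 0 a.
    by apply: ltr_pwDl; [apply: mulr_gt0|apply: mulr_ge0; rewrite // ltW].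
  (* If [a] is 0 then [b] is 1, and the second term alone is positive. *)
  have -> : a = 0 by apply/le_anti; rewrite a_le a0.
  by rewrite mul0r add0r mulr_gt0 //; lra.
have dD x : is_derive x (1 : R) D (N x) by apply: is_derive_exp2.
have dN x : is_derive x (1 : R) N (D x).
  have -> : N = fun y => a * expR y + (- b) * expR (- y).
    by apply/funext => y; rewrite /N mulNr.
  by have := is_derive_exp2 a (- b) x; rewrite [- b * _]mulNr opprK.
have D0 : D 0 = 1 by rewrite /D oppr0 expR0 !mulr1.
have N0 : N 0 = m by rewrite /N oppr0 expR0 !mulr1.
move=> s0; rewrite -/(D s); clearbody D N.
have ND x : 0 <= x -> N x <= (m + x) * D x.
  move=> x0; rewrite -ler_pdivrMr // -subr_le0.
  have -> : 0 = N 0 / D 0 - (m + 0) by rewrite D0 N0 divr1 addr0 subrr.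
  apply: (derive_le0_nincr_ge0 (f := fun y => N y / D y - (m + y))
    (df := fun y => (D y * D y - N y * N y) / D y ^+ 2 - 1)) x0 => [y|y _].
    have d1 := is_derive_div (lt0r_neq0 (D_gt0 y)) (dN y) (dD y).
    have d2 : is_derive y (1 : R) (fun y => m + y) (1 : R).
      by apply: is_derive_eq; rewrite add0r mulr1.
    exact: (is_deriveB d1 d2).
  rewrite mulrBl -!expr2 divff ?expf_neq0 ?lt0r_neq0 //.
  by rewrite addrAC subrr add0r oppr_le0 divr_ge0 ?sqr_ge0.
pose E x := expR (m * x + x ^+ 2 / 2).
have E_gt0 x : 0 < E x by apply: expR_gt0.
have dE x : is_derive x (1 : R) E ((m + x) * E x).
  have d1 : is_derive x (1 : R) (fun y => m * y) m.
    by apply: is_derive_eq; rewrite /GRing.scale /=; ring.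
  have d2 : is_derive x (1 : R) (fun y => y ^+ 2 / 2) x.
    by apply: is_derive_eq; rewrite /GRing.scale /=; field.
  have d : is_derive x (1 : R) (fun y => m * y + y ^+ 2 / 2) (m + x).
    exact: (is_deriveD d1 d2).
  by apply: is_derive_eq; rewrite /GRing.scale /= mulrC.
rewrite -/(E s) -[leRHS]mul1r -ler_pdivrMr //.
have E0 : E 0 = 1 by rewrite /E mulr0 expr0n /= mul0r addr0 expR0.
have -> : 1 = D 0 / E 0 by rewrite D0 E0 divr1.
clearbody E.
apply: (derive_le0_nincr_ge0 (f := fun y => D y / E y)) s0 => [y|y y0].
  exact: is_derive_div (lt0r_neq0 (E_gt0 y)) (dD y) (dE y).
rewrite mulr_le0_ge0 ?invr_ge0 ?sqr_ge0 // subr_le0 mulrA.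
by rewrite ler_pM2r // mulrC ND.
Qed.

End Hoeffding.

(** * Independent repetition of randomized computations and the concentration bound *)

Section Computations.
Variables (R : realType).

(** The summand [g] receives the probability as an argument, so that the rule can be iterated
    through nested binds; running times are ignored. *)
Lemma big_bind (V : nmodType) (T U : Type) (m : Defs.comp R T)
    (f : T -> Defs.comp R U) (g : R -> U -> V) :
  \sum_(z <- bind m f) g z.1.1 z.2
  = \sum_(x <- m) \sum_(y <- f x.2) g (x.1.1 * y.1.1) y.2.
Proof. by rewrite /bind big_allpairs_dep. Qed.

Lemma big_ret (V : nmodType) (T : Type) (a : T) (g : R -> T -> V) :
  \sum_(z <- ret R a) g z.1.1 z.2 = g 1 a.
Proof. by rewrite /ret big_seq1. Qed.

Lemma mem_bind (T U : eqType) (m : Defs.comp R T) (f : T -> Defs.comp R U) z :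
  z \in bind m f -> exists x y, [/\ x \in m, y \in f x.2 &
    z = (x.1.1 * y.1.1, (x.1.2 + y.1.2)%N, y.2)].
Proof. by case/allpairsPdep => x [y []]; exists x, y. Qed.

Lemma big_repeat (T : Type) (m : Defs.comp R T) (N : nat)
    (g : R -> seq T -> R) :
  \sum_(x <- repeat N.+1 m) g x.1.1 x.2
  = \sum_(a <- m) \sum_(x <- repeat N m) g (a.1.1 * x.1.1) (a.2 :: x.2).
Proof.
rewrite /= (big_bind _ _ g); apply: eq_bigr => a _.
rewrite (big_bind _ _ (fun w => g (a.1.1 * w))); apply: eq_bigr => x _.
by rewrite (big_ret _ (fun w => g (a.1.1 * (x.1.1 * w)))) mulr1.
Qed.

(** Independence: probabilities multiply along the repetitions, so the expectation of a product over
    the samples factorizes. *)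
Lemma repeat_prod (T : Type) (m : Defs.comp R T) (N : nat) (f : T -> R) :
  \sum_(x <- repeat N m) x.1.1 * \prod_(h <- x.2) f h
  = (\sum_(x <- m) x.1.1 * f x.2) ^+ N.
Proof.
elim: N => [|N IH].
  by rewrite (big_ret _ (fun w hs => w * \prod_(h <- hs) f h)) big_nil mulr1.
rewrite (big_repeat _ _ (fun w hs => w * \prod_(h <- hs) f h)) exprS -IH.
rewrite mulr_suml; apply: eq_bigr => a _; rewrite mulr_sumr.
by apply: eq_bigr => x _; rewrite big_cons; ring.
Qed.

Lemma repeat_mass (T : Type) (m : Defs.comp R T) (N : nat) :
  \sum_(x <- m) x.1.1 = 1 -> \sum_(x <- repeat N m) x.1.1 = 1.
Proof.
move=> m1; have := repeat_prod m N (fun=> 1).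
under eq_bigr do rewrite big1_eq mulr1.
by under [X in _ = X ^+ _ -> _]eq_bigr do rewrite mulr1; rewrite m1 expr1n.
Qed.

Lemma mem_repeat (T : eqType) (m : Defs.comp R T) (N : nat) x :
  x \in repeat N.+1 m -> exists a y, [/\ a \in m, y \in repeat N m &
    x = (a.1.1 * y.1.1, (a.1.2 + y.1.2)%N, a.2 :: y.2)].
Proof.
case/mem_bind => a [y [am /mem_bind[z [? [zm]]]]].
rewrite inE => /eqP-> /= -> ->.
by exists a, z; split => //; rewrite mulr1 addn0.
Qed.

Lemma size_repeat (T : eqType) (m : Defs.comp R T) (N : nat) x :
  x \in repeat N m -> size x.2 = N.
Proof.
elim: N x => [|N IH] x; first by rewrite inE => /eqP->.
by case/mem_repeat => a [y [_ /IH <- ->]].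
Qed.

Lemma repeat_ge0 (T : eqType) (m : Defs.comp R T) (N : nat) x :
  (forall y, y \in m -> 0 <= y.1.1) -> x \in repeat N m -> 0 <= x.1.1.
Proof.
move=> m0; elim: N x => [|N IH] x; first by rewrite inE => /eqP->.
by case/mem_repeat => a [y [/m0 a0 /IH y0 ->]]; apply: mulr_ge0.
Qed.

Lemma repeat_runtime (T : eqType) (m : Defs.comp R T) (N t : nat) :
  runtime_le m t -> runtime_le (repeat N m) (N * t).
Proof.
move=> /allP mt; apply/allP; elim: N => [|N IH] x.
  by rewrite inE => /eqP->.
by case/mem_repeat => a [y [/mt at_ /IH yt ->]]; rewrite mulSn leq_add.
Qed.

(** Independence again, for events: equality with a given list splits into a test on the first
    sample and a test on the remaining ones. *)
Lemma Pr_repeat_map (T : Type) (U : eqType) (m : Defs.comp R T) (N : nat)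
    (f : T -> U) (vs : N.-tuple U) :
  Pr (repeat N m) (fun hs => [seq f h | h <- hs] == vs)
  = \prod_(v <- vs) \sum_(x <- m | f x.2 == v) x.1.1.
Proof.
case: vs => vs /= /eqP; elim: N vs => [|N IH] [|v vs] // => [_|[sz]].
  by rewrite /Pr big_mkcond big_seq1 big_nil.
rewrite big_cons -(IH _ sz) /Pr big_mkcond.
rewrite (big_repeat _ _ (fun w hs => if map f hs == v :: vs then w else 0)).
rewrite mulr_suml [RHS]big_mkcond /=; apply: eq_bigr => a _.
under eq_bigr do rewrite eqseq_cons.
case: (f a.2 == v) => /=; last by rewrite big1.
by rewrite mulr_sumr [RHS]big_mkcond.
Qed.

(** The variable 1 - f takes the values -1 and 1 and has mean 1 - mu, which reduces the bound to the
    two-point inequality. *)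
Lemma hoeffding_mgf (T : eqType) (m : Defs.comp R T) (f : T -> R) (t : R) :
  (forall x, x \in m -> 0 <= x.1.1) -> \sum_(x <- m) x.1.1 = 1 ->
  (forall x, x \in m -> f x.2 = 0 \/ f x.2 = 2) -> 0 <= t ->
  \sum_(x <- m) x.1.1 * expR (t * (\sum_(y <- m) y.1.1 * f y.2 - f x.2))
    <= expR (t ^+ 2 / 2).
Proof.
move=> m0 m1 f02 t0; set mu := \sum_(y <- m) y.1.1 * f y.2.
have mu0 : 0 <= mu.
  rewrite /mu big_seq sumr_ge0 // => x xm; rewrite mulr_ge0 ?m0 //.
  by case: (f02 _ xm) => ->; rewrite ?lexx ?ler0n.
have mu2 : mu <= 2.
  have -> : 2 = \sum_(x <- m) x.1.1 * 2 by rewrite -mulr_suml m1 mul1r.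
  rewrite /mu big_seq [leRHS]big_seq ler_sum // => x xm.
  by rewrite ler_wpM2l ?m0 //; case: (f02 _ xm) => ->; rewrite ?lexx ?ler0n.
(* On the values 0 and 2 of f, exp(t(1 - f)) agrees with an affine function of f, so the expectation
   depends only on the mean. *)
have -> : \sum_(x <- m) x.1.1 * expR (t * (mu - f x.2))
  = \sum_(x <- m) expR (t * (mu - 1)) *
      (x.1.1 * expR t + x.1.1 * f x.2 * ((expR (- t) - expR t) / 2)).
  apply: eq_big_seq => x xm; case: (f02 _ xm) => ->.
    have -> : t * (mu - 0) = t * (mu - 1) + t by ring.
    by rewrite expRD; field.
  have -> : t * (mu - 2) = t * (mu - 1) - t by ring.
  by rewrite expRD; field.
rewrite -mulr_sumr big_split /= -!mulr_suml m1 -/mu.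
have mge : -1 <= 1 - mu by lra.
have mle : 1 - mu <= 1 by lra.
have := hoeffding_two_point mge mle t0.
have -> : (1 - mu) * t + t ^+ 2 / 2 = t ^+ 2 / 2 - t * (mu - 1) by ring.
rewrite expRB ler_pdivlMr ?expR_gt0 //; apply: le_trans.
by rewrite le_eqVlt; apply/orP; left; apply/eqP; field.
Qed.

(** Chernoff's method: Markov's inequality for the exponential of t times the sum of the deviations
    mu - f, followed by independence and the one-sample bound. *)
Lemma hoeffding (T : eqType) (m : Defs.comp R T) (f : T -> R) (N : nat)
    (delta : R) :
  (forall x, x \in m -> 0 <= x.1.1) -> \sum_(x <- m) x.1.1 = 1 ->
  (forall x, x \in m -> f x.2 = 0 \/ f x.2 = 2) ->
  (0 < N)%N -> 0 < delta -> delta < 1 ->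
  1 - delta <= Pr (repeat N m) (fun hs =>
    \sum_(x <- m) x.1.1 * f x.2 <= (size hs)%:R^-1 * \sum_(h <- hs) f h
      + Num.sqrt (2 / N%:R * ln (1 / delta))).
Proof.
move=> m0 m1 f02 N0 d0 d1; set mu := \sum_(x <- m) _.
(* The deviation [t] also serves as exponential parameter: -N t u + N u^2/2 is minimal at u = t. *)
set t := Num.sqrt _; set P := fun _ => _.
have N0R : 0 < N%:R :> R by rewrite ltr0n.
have tge0 : 0 <= t by apply: sqrtr_ge0.
have t2 : t ^+ 2 = 2 / N%:R * - ln delta.
  rewrite sqr_sqrtr; first by rewrite div1r lnV.
  rewrite mulr_ge0 ?divr_ge0 ?ler0n // ln_ge0 //.
  by rewrite ler_pdivlMr // mul1r ltW.
have -> : Pr (repeat N m) P = 1 - Pr (repeat N m) (predC P).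
  by rewrite -(repeat_mass N m1) (bigID (fun x => P x.2)) /= addrK.
rewrite lerD2l lerN2.
(* Markov's inequality termwise: the factor multiplying the probability is at least 1 on the failure
   event and nonnegative elsewhere. *)
apply: (@le_trans _ _ (\sum_(x <- repeat N m)
   expR (- (N%:R * t ^+ 2)) * (x.1.1 * \prod_(h <- x.2) expR (t * (mu - f h))))).
  rewrite /Pr big_mkcond /= [leLHS]big_seq [leRHS]big_seq ler_sum // => x xm.
  have x0 := repeat_ge0 m0 xm.
  have e0 : 0 <= \prod_(h <- x.2) expR (t * (mu - f h)).
    by apply: prodr_ge0 => h _; apply: expR_ge0.
  case: ifPn => [|_]; last by rewrite !mulr_ge0 ?expR_ge0.
  rewrite /P (size_repeat xm) -ltNge => lt_mu.
  rewrite mulrCA -[leLHS]mulr1 ler_wpM2l // -expR_sum -expRD.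
  rewrite -[leLHS]expR0 ler_expR.
  rewrite -mulr_sumr sumrB big_const_seq count_predT iter_addr_0.
  rewrite (size_repeat xm).
  rewrite expr2 mulrA [_ * t]mulrC -mulrN -mulrDr mulr_ge0 //.
  rewrite -[mu *+ N]mulr_natl.
  rewrite addrC subr_ge0.
  move: lt_mu; rewrite -(ltr_pM2l N0R) mulrDr mulVKf ?gt_eqF // => /ltW.
  by rewrite lerBrDl.
rewrite -mulr_sumr repeat_prod.
apply: (@le_trans _ _ (expR (- (N%:R * t ^+ 2)) * expR (t ^+ 2 / 2) ^+ N)).
  rewrite ler_wpM2l ?expR_ge0 // lerXn2r ?nnegrE ?expR_ge0 //.
    by rewrite big_seq sumr_ge0 // => x xm; rewrite mulr_ge0 ?m0 ?expR_ge0.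
  exact: hoeffding_mgf.
rewrite -expRM_natl -expRD t2.
(* The total exponent is -N t^2/2, and [t] was chosen to make this ln delta. *)
have -> : - (N%:R * (2 / N%:R * - ln delta))
     + N%:R * (2 / N%:R * - ln delta / 2)
   = ln delta by field; rewrite gt_eqF.
by rewrite lnK.
Qed.

End Computations.

(** * Trajectories *)

(** Site tensors are functions, so equality of nodes is decided classically; it allows membership
    reasoning on lists of runs. *)
HB.instance Definition _ (R : realType) (n : nat) := gen_eqMixin (node R n).

Section Trajectories.
Variables (R : realType) (n : nat) (D : circuit R n) (chi : nat).
Variable (alg : algorithm R n).
Hypotheses (noisyD : noisy_circuit D) (corr : correct_algorithm D chi alg).

Local Notation proj M := (projector (mps_ket D M)).

Lemma current_rcons h v : current D (rcons h v) = node_out v.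
Proof. by rewrite /current map_rcons last_rcons. Qed.

Lemma reachable_size h : reachable D alg h -> (size h < layers D)%N.
Proof.
by have [L0 _ _] := noisyD; case=> [//|h' j _ lt _]; rewrite size_rcons.
Qed.

Lemma proj_update h j : reachable D alg h -> j \in outcomes D alg h ->
  proj (update alg h j)
  = ((branch_prob D alg h j)^-1)%:C%C *: projector (branch D alg h j).
Proof.
have [_ upd _] := corr => hr jo; rewrite upd // projectorZ exprVn.
by rewrite sqr_sqrtr // sqr_ge0.
Qed.

Lemma unit_update h j : reachable D alg h -> j \in outcomes D alg h ->
  unit_vector (mps_ket D (update alg h j)).
Proof.
move=> hr jo; apply/unit_vectorP; rewrite proj_update // mxtraceZ.
rewrite trace_projector -rmorphM /= mulVf //.
by move: jo; rewrite mem_filter => /andP[].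
Qed.

Lemma unit_current h :
  reachable D alg h -> unit_vector (mps_ket D (current D h)).
Proof.
have [_ u0 _] := noisyD; have [_ _ app] := corr.
case=> // h' j hr _ jo; rewrite current_rcons.
by case: (app _ (unit_update hr jo)).
Qed.

(** The Kraus branches left out of [outcomes] have probability 0, hence are zero vectors; each other
    branch projector is its probability times the projector of the normalized state. *)
Lemma channel_current h : reachable D alg h ->
  channel D (size h) (proj (current D h))
  = \sum_(j <- outcomes D alg h)
      (branch_prob D alg h j)%:C%C *: proj (update alg h j).
Proof.
have [kraus _ _] := corr => hr; rewrite kraus // (big_nth 0).
transitivity (\sum_(j <- outcomes D alg h) projector (branch D alg h j)).
  rewrite /outcomes big_filter [RHS]big_mkcond /index_iota subn0.
  apply: eq_bigr => j _; rewrite -projector_mul -/(branch D alg h j).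
  case: eqP => //= /eqP; rewrite sqrf_eq0 => /eqP/norm2_eq0 ->.
  by rewrite /projector mul0mx.
apply: eq_big_seq => j jo; rewrite proj_update // scalerA -rmorphM /=.
by rewrite divff ?scale1r //; move: jo; rewrite mem_filter => /andP[].
Qed.

(** Traces are taken in [channel_current]: the channel preserves the trace, and all states involved
    are unit vectors. *)
Lemma outcomes_mass h : reachable D alg h ->
  \sum_(j <- outcomes D alg h) branch_prob D alg h j = 1.
Proof.
move=> hr; apply: complexI; rewrite rmorph_sum rmorph1 /=.
have [_ _ /(_ _ (reachable_size hr))[_ tp]] := noisyD.
have /unit_vectorP <- := unit_current hr.
rewrite -(tp) channel_current // raddf_sum /=; apply: eq_big_seq => j jo.
by rewrite mxtraceZ (unit_vectorP _).1 ?mulr1 //; exact: unit_update.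
Qed.

Lemma channel_psd h X :
  reachable D alg h -> psd X -> psd (channel D (size h) X).
Proof.
have [kraus _ _] := corr => hr psdX; rewrite kraus //.
by apply: psd_sum => K _; apply: psd_conj.
Qed.

(** * The tree of runs: reachability, probabilities and properties of the current state *)

Definition layer_time h j : nat :=
  ((kraus_time alg h).+1 + update_time alg h j
   + approx_time alg (update alg h j))%N.

Lemma run_layerE h : run_layer D alg h
  = [seq (branch_prob D alg h j, layer_time h j, rcons h (new_node alg h j))
    | j <- outcomes D alg h].
Proof.
rewrite /run_layer /tick /bind /ret /sample /= !cats0.
rewrite -map_comp; elim: (outcomes _ _ _) => //= j js ->.
by rewrite !mulr1 mul1r addn0 add0n addnA.
Qed.

Lemma big_run_layers (V : nmodType) l (g : R -> history R n -> V) :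
  \sum_(z <- run_layers D alg l.+1) g z.1.1 z.2
  = \sum_(x <- run_layers D alg l) \sum_(j <- outcomes D alg x.2)
      g (x.1.1 * branch_prob D alg x.2 j) (rcons x.2 (new_node alg x.2 j)).
Proof.
rewrite (big_bind _ _ g); apply: eq_bigr => x _.
by rewrite run_layerE big_map.
Qed.

Lemma mem_run_layers l z : z \in run_layers D alg l.+1 ->
  exists x j, [/\ x \in run_layers D alg l, j \in outcomes D alg x.2 &
    z = (x.1.1 * branch_prob D alg x.2 j, (x.1.2 + layer_time x.2 j)%N,
         rcons x.2 (new_node alg x.2 j))].
Proof.
case/mem_bind => x [y [xl]]; rewrite run_layerE => /mapP[j jo ->] ->.
by exists x, j.
Qed.

(** The inequality is strict because [reachable] covers only histories before the last layer. *)
Lemma run_layers_reachable l x : (l < layers D)%N ->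
  x \in run_layers D alg l -> reachable D alg x.2 /\ size x.2 = l.
Proof.
elim: l x => [|l IH] x lL; first
  by rewrite inE => /eqP->; split=> //; constructor.
case/mem_run_layers => y [j [/(IH _ (ltnW lL))[yr ys] jo ->]] /=.
by rewrite size_rcons ys; split=> //; apply: reach_step; rewrite // ys.
Qed.

Lemma run_layers_ge0 l x : x \in run_layers D alg l -> 0 <= x.1.1.
Proof.
elim: l x => [|l IH] x; first by rewrite inE => /eqP->; rewrite ler01.
case/mem_run_layers => y [j [/IH y0 jo ->]] /=.
by rewrite mulr_ge0 // sqr_ge0.
Qed.

Lemma run_layers_mass l : (l <= layers D)%N ->
  \sum_(x <- run_layers D alg l) x.1.1 = 1.
Proof.
elim: l => [|l IH] lL; first by rewrite /= (big_ret _ (fun w _ => w)).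
rewrite (big_run_layers l (fun w _ => w)) -(IH (ltnW lL)).
apply: eq_big_seq => x xl; rewrite -mulr_sumr outcomes_mass ?mulr1 //.
by case: (run_layers_reachable lL xl).
Qed.

(* [correct_algorithm] provides Kraus decompositions at reachable histories only;
   there is one at each layer because the run probabilities add up to 1. *)
Lemma layer_psd l X : (l < layers D)%N -> psd X -> psd (channel D l X).
Proof.
move=> lL psdX; have := run_layers_mass (ltnW lL).
case E: (run_layers D alg l) => [|x xs].
  by rewrite big_nil => /eqP; rewrite eq_sym oner_eq0.
have xl : x \in run_layers D alg l by rewrite E inE eqxx.
by have [xr <-] := run_layers_reachable lL xl => _; apply: channel_psd.
Qed.

(** Complete histories are not [reachable], so the last layer is peeled off and the previous history
    is used. *)
Lemma unit_run_layers l x : (l <= layers D)%N -> x \in run_layers D alg l ->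
  unit_vector (mps_ket D (current D x.2)).
Proof.
have [_ u0 _] := noisyD; have [_ _ app] := corr.
case: l => [|l] lL; first by rewrite inE => /eqP->.
case/mem_run_layers => y [j [yl jo ->]] /=; rewrite current_rcons.
have [yr _] := run_layers_reachable lL yl.
by case: (app _ (unit_update yr jo)).
Qed.

(** Depth 0 is excluded: [chi] bounds the outputs of [approx], not the initial MPS. *)
Lemma bond_run_layers l x : (0 < l <= layers D)%N -> x \in run_layers D alg l ->
  (bond_dim (current D x.2) <= chi)%N.
Proof.
have [_ _ app] := corr.
case: l => [//|l] /= lL.
case/mem_run_layers => y [j [yl jo ->]] /=; rewrite current_rcons.
have [yr _] := run_layers_reachable lL yl.
by case: (app _ (unit_update yr jo)).
Qed.

(** * Exact trajectories and the trace distance to the final state *)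

(** This is the test of [eps_bound] at threshold 2; as the errors are nonnegative, it says that each
    of them is 0. *)
Definition exact_history (h : history R n) : bool :=
  \sum_(v <- h) eps_approx D v <= 0.

Lemma eps_approx_ge0 v : 0 <= eps_approx D v.
Proof. exact: trace_norm_ge0. Qed.

Lemma eps_boundE h : eps_bound D 2 h = if exact_history h then 0 else 2.
Proof.
rewrite /eps_bound subrr -/(exact_history h); case: ifP => // h0.
apply/le_anti/andP; split=> //.
by apply: sumr_ge0 => v _; apply: eps_approx_ge0.
Qed.

Lemma exact_rcons h v :
  exact_history (rcons h v) = exact_history h && (eps_approx D v <= 0).
Proof.
rewrite /exact_history -cats1 big_cat /= big_seq1.
have h0 : 0 <= \sum_(w <- h) eps_approx D w.
  by rewrite sumr_ge0 // => w _; apply: eps_approx_ge0.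
have v0 := eps_approx_ge0 v.
by apply/idP/andP => [le0|[] le0 le1]; [split|]; lra.
Qed.

(** Only the projectors agree; the vectors may still differ by a phase. *)
Lemma eps_approx_le0 v :
  eps_approx D v <= 0 -> proj (node_out v) = proj (node_in v).
Proof.
move=> v0; apply/esym/eqP; rewrite -subr_eq0; apply/eqP/trace_norm_eq0.
by apply/le_anti; rewrite v0 eps_approx_ge0.
Qed.

(** Left unnormalized, so that its trace is the probability of [S]. Exact histories give the
    operator G at depth [l], the other ones give B. *)
Definition mixture (S : pred (history R n)) l : operator R n :=
  \sum_(x <- run_layers D alg l | S x.2) x.1.1%:C%C *: proj (current D x.2).

Lemma mixture_psd S l : psd (mixture S l).
Proof.
rewrite /mixture big_seq_cond; apply: psd_sum => x /andP[xl _].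
by apply: psdZ (psd_projector _); apply: run_layers_ge0 xl.
Qed.

Lemma mixture_trace S l : (l <= layers D)%N ->
  \tr (mixture S l) = (Pr (run_layers D alg l) S)%:C%C.
Proof.
move=> lL; rewrite /Pr rmorph_sum raddf_sum /= big_seq_cond [RHS]big_seq_cond.
apply: eq_bigr => x /andP[xl _].
by rewrite mxtraceZ (unit_vectorP _).1 ?mulr1 //; apply: unit_run_layers xl.
Qed.

Lemma state_trace l : (l <= layers D)%N -> \tr (state_after D l) = 1.
Proof.
have [_ u0 ch] := noisyD.
elim: l => [|l IH] lL /=; first exact/unit_vectorP.
by have [_ ->] := ch _ lL; apply: IH; apply: ltnW.
Qed.

Lemma exact_mixture_le l : (l <= layers D)%N ->
  psd (state_after D l - mixture exact_history l).
Proof.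
elim: l => [|l IH] lL.
  (* The empty history is exact, so at depth 0 the difference is 0. *)
  rewrite /mixture /= big_mkcond big_seq1 /= /exact_history big_nil lexx.
  by rewrite scale1r subrr; apply: psd0.
have := layer_psd lL (IH (ltnW lL)); rewrite linearB /= => psd1.
set G := mixture _ l.+1.
(* The first summand is the channel applied to the induction hypothesis; the second is the part of
   the exact mixture lost in this layer. *)
have -> : channel D l (state_after D l) - G
  = (channel D l (state_after D l) - channel D l (mixture exact_history l))
    + (channel D l (mixture exact_history l) - G) by rewrite addrA subrK.
apply: psdD psd1 _.
have -> : channel D l (mixture exact_history l)
  = \sum_(x <- run_layers D alg l | exact_history x.2)
     \sum_(j <- outcomes D alg x.2)
      (x.1.1 * branch_prob D alg x.2 j)%:C%C *: proj (update alg x.2 j).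
  rewrite linear_sum /= big_seq_cond [RHS]big_seq_cond.
  apply: eq_bigr => x /andP[xl _]; have [xr <-] := run_layers_reachable lL xl.
  rewrite linearZ /= channel_current // scaler_sumr; apply: eq_bigr => j _.
  by rewrite scalerA -rmorphM.
(* A history is exact when its prefix and its last node are; at such a node the projectors before
   and after approximation coincide. *)
have -> : G = \sum_(x <- run_layers D alg l | exact_history x.2)
     \sum_(j <- outcomes D alg x.2 | eps_approx D (new_node alg x.2 j) <= 0)
      (x.1.1 * branch_prob D alg x.2 j)%:C%C *: proj (update alg x.2 j).
  rewrite /G /mixture big_mkcond.
  rewrite (big_run_layers l (fun w h => if exact_history h
    then w%:C%C *: proj (current D h) else 0)).
  rewrite [RHS]big_mkcond; apply: eq_bigr => x _.
  under eq_bigr do rewrite exact_rcons current_rcons.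
  case: (exact_history x.2) => /=; last by rewrite big1.
  rewrite [RHS]big_mkcond; apply: eq_bigr => j _.
  by case: ifP => // /eps_approx_le0 ->.
rewrite -sumrB big_seq_cond; apply: psd_sum => x /andP[xl _].
(* What survives the subtraction are the branches leaving an exact history by an inexact
   approximation, with nonnegative weights. *)
rewrite (bigID (fun j => eps_approx D (new_node alg x.2 j) <= 0)) /=.
rewrite [X in X - _]addrC addrK; apply: psd_sum => j _.
apply: psdZ (psd_projector _); rewrite mulr_ge0 ?sqr_ge0 //.
exact: run_layers_ge0 xl.
Qed.

Lemma mean_eps_bound :
  \sum_(x <- run_trajectory D alg) x.1.1 * eps_bound D 2 x.2
  = Pr (run_trajectory D alg) (predC exact_history) *+ 2.
Proof.
rewrite /Pr -sumrMnl [RHS]big_mkcond; apply: eq_bigr => x _ /=.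
by rewrite eps_boundE; case: ifP => _ /=; rewrite ?mulr0 // mulr_natr.
Qed.

Lemma trace_distance_le :
  trace_norm (final_state D
    - \sum_(x <- run_trajectory D alg) x.1.1%:C%C *: proj (current D x.2))
  <= \sum_(x <- run_trajectory D alg) x.1.1 * eps_bound D 2 x.2.
Proof.
(* The output mixture is split as G + B and the difference regrouped as (rho - G) - B. *)
rewrite (bigID (fun x => exact_history x.2)) /= opprD addrA.
rewrite -lecR mean_eps_bound.
have L := leqnn (layers D).
apply: le_trans (trace_norm_psdB (exact_mixture_le L)
  (mixture_psd (predC exact_history) (layers D))) _.
rewrite linearB /= state_trace // !mixture_trace //.
rewrite -(rmorph1 (real_complex R)) -rmorphB -rmorphD lecR mulr2n lerD2r.
rewrite lerBlDr -{1}(run_layers_mass L).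
by rewrite [leLHS](bigID (fun x => exact_history x.2)) /= addrC.
Qed.

End Trajectories.

(** * Running time *)

Section Polynomial.
Local Open Scope nat_scope.
Implicit Types f g : nat -> nat.

(** Existence of a bound suffices: nested time bounds are handled through closure rules, without
    explicit constants. *)
Definition poly_dominated f :=
  exists c k : nat, forall s, f s <= poly_bound c k s.

Lemma poly_bound_mono c k s t : s <= t -> poly_bound c k s <= poly_bound c k t.
Proof.
move=> st; rewrite leq_mul2l; apply/orP; right.
by case: k => [|k]; rewrite ?expn0 // leq_exp2r.
Qed.

Lemma poly_dominated_const a : poly_dominated (fun=> a).
Proof. by exists a, 0 => s; rewrite /poly_bound expn0 muln1. Qed.

Lemma poly_dominated_id : poly_dominated id.
Proof. by exists 1, 1 => s; rewrite /poly_bound mul1n expn1. Qed.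

Lemma poly_dominatedM f g :
  poly_dominated f -> poly_dominated g -> poly_dominated (fun s => f s * g s).
Proof.
move=> [a [i fa]] [b [j gb]]; exists (a * b), (i + j) => s.
apply: leq_trans (leq_mul (fa s) (gb s)) _.
by rewrite /poly_bound expnD mulnACA.
Qed.

Lemma poly_dominatedD f g :
  poly_dominated f -> poly_dominated g -> poly_dominated (fun s => f s + g s).
Proof.
move=> [a [i fa]] [b [j gb]]; exists (a + b), (i + j) => s.
apply: leq_trans (leq_add (fa s) (gb s)) _; rewrite /poly_bound mulnDl.
by apply: leq_add; rewrite leq_mul2l leq_pexp2l ?orbT // ?leq_addr ?leq_addl.
Qed.

Lemma poly_dominatedX f k :
  poly_dominated f -> poly_dominated (fun s => f s ^ k).
Proof.
move=> fd; elim: k => [|k IH].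
  by have [c [j h]] := poly_dominated_const 1; exists c, j => s; rewrite expn0.
have [c [j h]] := poly_dominatedM fd IH.
by exists c, j => s; rewrite expnS.
Qed.

Lemma poly_dominated_comp c k f :
  poly_dominated f -> poly_dominated (fun s => poly_bound c k (f s)).
Proof.
move=> fd; apply: poly_dominatedM (poly_dominated_const c) _.
apply: poly_dominatedX.
have [a [j h]] := poly_dominatedD (poly_dominated_const 1) fd.
by exists a, j => s; rewrite -add1n.
Qed.

End Polynomial.

(** * Bond dimensions and running time of one trajectory *)

Section Runtime.
Variables (R : realType) (n : nat) (D : circuit R n) (chi c k s : nat).
Variable (alg : algorithm R n).
Hypotheses (noisyD : noisy_circuit D) (corr : correct_algorithm D chi alg).
Hypotheses (effD : efficient_circuit D chi c k).
Hypotheses (effA : efficient_algorithm D alg c k) (le_s : (n + chi <= s)%N).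

Local Notation P := (poly_bound c k).
(** The term [P s] covers the initial MPS, and [s], being at least [chi], covers every output of
    [approx]. *)
Definition current_bond_bound : nat := (P s + s)%N.
Definition update_bond_bound : nat := P (s + current_bond_bound).
(** A sum in place of a maximum, to fit the closure rules for polynomial bounds. *)
Definition history_bond_bound : nat :=
  (current_bond_bound + update_bond_bound)%N.
Definition layer_time_bound : nat :=
  ((P (s + P s + history_bond_bound)).+1 + P (s + current_bond_bound)
   + P (s + update_bond_bound))%N.

(** Bond dimensions do not compound over the layers: after the initial state, each layer starts from
    an output of [approx]. *)
Lemma current_bond_le h : reachable D alg h ->
  (bond_dim (current D h) <= current_bond_bound)%N.
Proof.
have [_ init_le] := effD; have [_ _ app] := corr.
case=> [|h' j hr _ jo].
  apply: leq_trans init_le (leq_trans _ (leq_addr _ _)).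
  exact: poly_bound_mono.
rewrite current_rcons; have [_ out_le] := app _ (unit_update corr hr jo).
by apply: leq_trans out_le _; rewrite /current_bond_bound; lia.
Qed.

Lemma update_bond_le h j : reachable D alg h -> j \in outcomes D alg h ->
  (bond_dim (update alg h j) <= update_bond_bound)%N.
Proof.
have [_ _ upd _] := effA => hr jo; apply: leq_trans (upd _ _ hr jo) _.
by apply: poly_bound_mono; apply: leq_add (current_bond_le hr); lia.
Qed.

Lemma history_bond_le h : reachable D alg h ->
  (history_bond D h <= history_bond_bound)%N.
Proof.
have [_ _ app] := corr; rewrite /history_bond /history_bond_bound => hr.
have init_le := current_bond_le (reach_init D alg).
rewrite geq_max (leq_trans init_le (leq_addr _ _)) /=.
elim: hr => [|h' j hr IH _ jo]; first by rewrite big_nil.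
rewrite -cats1 big_cat big_seq1 /= geq_max IH /= geq_max.
have := update_bond_le hr jo.
have [_ out_le] := app _ (unit_update corr hr jo).
by rewrite /current_bond_bound; lia.
Qed.

Lemma layer_time_le h j : reachable D alg h -> j \in outcomes D alg h ->
  (layer_time alg h j <= layer_time_bound)%N.
Proof.
have [kt ut _ at_] := effA => hr jo.
have [L_le _] := effD; have hL := reachable_size noisyD hr.
rewrite /layer_time /layer_time_bound.
apply: leq_add; first apply: leq_add.
- rewrite ltnS; apply: leq_trans (kt _ hr) _; apply: poly_bound_mono.
  apply: leq_add (history_bond_le hr); apply: leq_add; first by lia.
  apply: leq_trans (ltnW hL) (leq_trans L_le _).
  by apply: poly_bound_mono; lia.
- apply: leq_trans (ut _ _ hr jo) _; apply: poly_bound_mono.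
  by apply: leq_add (current_bond_le hr); lia.
- apply: leq_trans (at_ _ (unit_update corr hr jo)) _.
  apply: poly_bound_mono.
  by apply: leq_add (update_bond_le hr jo); lia.
Qed.

Lemma run_trajectory_runtime :
  runtime_le (run_trajectory D alg) (P s * layer_time_bound).
Proof.
have [L_le _] := effD.
suff H l x : (l <= layers D)%N -> x \in run_layers D alg l ->
    (x.1.2 <= l * layer_time_bound)%N.
  apply/allP => x xL; apply: leq_trans (H _ _ (leqnn _) xL) _.
  rewrite leq_mul2r; apply/orP; right; apply: leq_trans L_le _.
  by apply: poly_bound_mono; lia.
elim: l x => [|l IH] x lL; first by rewrite inE => /eqP->.
case/mem_run_layers => y [j [yl jo ->]] /=; rewrite mulSn addnC.
have [yr _] := run_layers_reachable lL yl.
by apply: leq_add; [apply: layer_time_le|apply: IH (ltnW lL) yl].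
Qed.

End Runtime.

(** Here s stands for n + chi + N, and its first occurrence as a factor bounds the number N of
    repetitions. The resulting constants depend on [c] and [k] only, so they can be fixed before the
    circuit. *)
Lemma total_time_poly (c k : nat) : poly_dominated (fun s =>
  s * (poly_bound c k s * layer_time_bound c k s))%N.
Proof.
have cst := poly_dominated_const; have idd := poly_dominated_id.
have compd := @poly_dominated_comp c k.
have Ps := compd _ idd.
have cb : poly_dominated (current_bond_bound c k) by apply: poly_dominatedD.
have ub : poly_dominated (update_bond_bound c k).
  by apply: compd; apply: poly_dominatedD.
have hb : poly_dominated (history_bond_bound c k) by apply: poly_dominatedD.
apply: poly_dominatedM => //; apply: poly_dominatedM => //.
apply: poly_dominatedD; last by apply: compd; apply: poly_dominatedD.
apply: poly_dominatedD; last by apply: compd; apply: poly_dominatedD.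
apply: (poly_dominatedD (cst 1)); apply: compd.
by apply: poly_dominatedD => //; apply: poly_dominatedD.
Qed.

(** * Assembly of the witness, the running time and the confidence bound *)

Theorem theorem1 (R : realType) (c k : nat) :
  exists c' k' : nat,
  forall (n : nat) (D : circuit R n) (chi : nat) (alg : algorithm R n) (N : nat),
  noisy_circuit D ->
  efficient_circuit D chi c k ->
  correct_algorithm D chi alg ->
  efficient_algorithm D alg c k ->
  (0 < N)%N ->
  exists eps : R,
  [/\ 0 <= eps,
      runtime_le (repeat N (run_trajectory D alg))
        (poly_bound c' k' (n + chi + N)),
      exists E : seq (R * ket R n),
        convex_mps_witness (qubit_order D) (final_state D) eps chi E
        /\ returns_samples D N (repeat N (run_trajectory D alg)) E &
      forall delta : R, 0 < delta -> delta < 1 ->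
        1 - delta <=
        Pr (repeat N (run_trajectory D alg))
          (fun hs => eps <= error_estimator D 2 hs
                            + Num.sqrt (2 / N%:R * ln (1 / delta)))].
Proof.
have [c' [k' time_le]] := total_time_poly c k.
exists c', k' => n D chi alg N noisyD effD corr effA N0.
have [L0 _ _] := noisyD.
set m := run_trajectory D alg.
have m0 x : x \in m -> 0 <= x.1.1 by apply: run_layers_ge0.
have m1 : \sum_(x <- m) x.1.1 = 1 by apply: (run_layers_mass noisyD corr).
have eps02 x : x \in m -> eps_bound D 2 x.2 = 0 \/ eps_bound D 2 x.2 = 2.
  by rewrite eps_boundE; case: ifP; [left|right].
exists (\sum_(x <- m) x.1.1 * eps_bound D 2 x.2); split.
- rewrite big_seq; apply: sumr_ge0 => x xm.
  by apply: mulr_ge0; [apply: m0|case: (eps02 x xm) => ->].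
- have le_s : (n + chi <= n + chi + N)%N by lia.
  have := repeat_runtime N (run_trajectory_runtime noisyD corr effD effA le_s).
  move=> /allP runt; apply/allP => x /runt /leq_trans; apply.
  apply: leq_trans (time_le _); rewrite leq_mul2r; apply/orP; right; lia.
- exists [seq (x.1.1, output D x.2) | x <- m]; split.
    split=> [|||].
    + by rewrite all_map; apply/allP => x /m0.
    + by rewrite big_map.
    + move=> e /mapP[x xm ->] /=; split.
        by apply: (unit_run_layers noisyD corr (leqnn _) xm).
      exists (current D x.2) => //.
      (* There is at least one layer, so the final state is an output of [approx]. *)
      by apply: (bond_run_layers corr _ xm); rewrite L0 leqnn.
    + by rewrite big_map; apply: (trace_distance_le noisyD corr).
  move=> vs; rewrite Pr_repeat_map; apply: eq_bigr => v _.
  by rewrite /ensemble_mass big_map.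
- move=> delta d0 d1.
  exact: (hoeffding m0 m1 eps02 N0 d0 d1).
Qed.
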